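(* The value function $V:[0,+\infty)\to\mathbb{R}$ satisfies: (i) $\lim_{k\to+\infty}V(k)=+\infty$; (ii) $\lim_{k\to+\infty}\dfrac{V(k)}{k}=0$; (iii) $\lim_{k\to0}V(k)=V(0)=0$.
   Context: Production function: $F:\mathbb{R}\to\mathbb{R}$ is $\mathcal{C}^1$ with $F'>0$ on $\mathbb{R}$, $F(0)=0$, $\lim_{x\to+\infty}F(x)=+\infty$, $L:=\lim_{x\to+\infty}F'(x)>0$; for some $0<\underline{k}<\overline{k}$, $F$ is concave on $[0,\underline{k}]$ and on $[\overline{k},+\infty)$ and convex on $[\underline{k},\overline{k}]$. Utility: $\rho>0$, and $u:[0,+\infty)\to\mathbb{R}$ is strictly increasing and strictly concave, continuous on $[0,+\infty)$ and $\mathcal{C}^2$ on $(0,+\infty)$, with $u(0)=0$, $\lim_{x\to+\infty}u(x)=+\infty$, $\lim_{x\to0^+}u'(x)=+\infty$, $\lim_{x\to+\infty}u'(x)=0$; $\epsilon_0>0$ is a fixed constant with $\lim_{t\to+\infty}e^{\epsilon_0 t}e^{-\rho t}u\left(e^{(L+\epsilon_0)t}\right)=0$. State equation: for $k_0\ge0$ and $c\in\mathcal{L}^1_{loc}([0,+\infty),\mathbb{R})$ (integrable on each bounded interval $[0,T]$), $k(\cdot;k_0,c)$ is the unique (locally absolutely continuous) solution of $k(0)=k_0$, $\dot k(t)=F(k(t))-c(t)$ for (a.e.) $t\ge0$. Admissible controls: $\Lambda(k_0)$ is the set of $c\in\mathcal{L}^1_{loc}([0,+\infty),\mathbb{R})$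 such that $c\ge0$ almost everywhere and $k(\cdot;k_0,c)\ge0$ (i.e. the solution is defined and nonnegative on all of $[0,+\infty)$). Functional and value function: $U(c;k_0):=\int_0^{+\infty}e^{-\rho t}u(c(t))\,dt$ for $c\in\Lambda(k_0)$, and $V:[0,+\infty)\to\mathbb{R}$, $V(k_0):=\sup_{c\in\Lambda(k_0)}U(c;k_0)$. *)

(* Defs.v *)
From HB Require Import structures.
From mathcomp Require Import all_boot all_order all_algebra.
From mathcomp Require Import all_classical all_reals all_analysis.

Set Implicit Arguments.
Unset Strict Implicit.
Unset Printing Implicit Defensive.

Import Order.TTheory GRing.Theory Num.Theory.
Import numFieldNormedType.Exports.

Local Open Scope classical_set_scope.
Local Open Scope ring_scope.

Definition concave_function (R : realType) (D : set R) (f : R -> R) : Prop :=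
  convex_function (E := R^o) D (fun x => - f x).

Definition strictly_concave_function (R : realType) (D : set R) (f : R -> R) :
    Prop :=
  forall x y t : R, D x -> D y -> x != y -> 0 < t < 1 ->
    t * f x + (1 - t) * f y < f (t * x + (1 - t) * y).

Record production_function (R : realType) (L : R) (F : R -> R) : Prop := {
  prod_derivable : forall x, derivable F x 1 ;
  prod_C1 : continuous (derive1 F) ;
  prod_deriv_gt0 : forall x, 0 < derive1 F x ;
  prod_0 : F 0 = 0 ;
  prod_pinfty : F x @[x --> +oo] --> +oo ;
  prod_deriv_lim : derive1 F x @[x --> +oo] --> L ;
  prod_lim_gt0 : 0 < L ;
  prod_shape : exists ku ko : R, [/\ 0 < ku /\ ku < ko,
    concave_function `[0, ku] F,
    concave_function `[ko, +oo[ F &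
    convex_function (E := R^o) `[ku, ko] F] }.

(* A utility is a function on [0, +oo[; it is represented by a total function
   on R, about which nothing is assumed on the negative half-line. *)
Record utility_function (R : realType) (u : R -> R) : Prop := {
  util_increasing : {in `[0, +oo[ &, {homo u : x y / x < y}} ;
  util_concave : strictly_concave_function `[0, +oo[ u ;
  util_continuous : {within `[0, +oo[, continuous u} ;
  util_derivable : forall x, 0 < x -> derivable u x 1 ;
  util_derivable2 : forall x, 0 < x -> derivable (derive1 u) x 1 ;
  util_C2 : forall x, 0 < x -> {for x, continuous (derive1 (derive1 u))} ;
  util_0 : u 0 = 0 ;
  util_pinfty : u x @[x --> +oo] --> +oo ;
  util_deriv_0 : derive1 u x @[x --> 0^'+] --> +oo ;
  util_deriv_pinfty : derive1 u x @[x --> +oo] --> (0 : R) }.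

(* The library's [locally_integrable] is for open domains, hence does not
   apply to [0, +oo[. *)
Definition L1loc (R : realType) (c : R -> R) : Prop :=
  forall T : R, 0 <= T ->
    (@lebesgue_measure R).-integrable `[0, T] (EFin \o c).

Definition absolutely_continuous_on (R : realType) (a b : R) (f : R -> R) :
    Prop :=
  forall e : R, 0 < e -> exists2 d : R, 0 < d &
    forall (n : nat) (x y : nat -> R),
      (forall i, (i < n)%N -> [/\ a <= x i, x i <= y i & y i <= b]) ->
      trivIset `I_n (fun i => `]x i, y i[%classic) ->
      \sum_(i < n) (y i - x i) < d ->
      \sum_(i < n) `|f (y i) - f (x i)| < e.

(* [k] is a locally absolutely continuous solution on [0, +oo[ of the Cauchy
   problem k' = F(k) - c, k(0) = k0; its values at negative times are
   irrelevant. *)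
Definition state_solution (R : realType) (F : R -> R) (k0 : R) (c k : R -> R) :
    Prop :=
  [/\ k 0 = k0,
      forall T : R, 0 <= T -> absolutely_continuous_on 0 T k &
      {ae @lebesgue_measure R, forall t : R, 0 <= t ->
         is_derive t 1 k (F (k t) - c t)}].

(* As the solution of the state equation is unique when it exists, quantifying
   existentially over it amounts to speaking of k(.; k0, c). *)
Definition admissible (R : realType) (F : R -> R) (k0 : R) : set (R -> R) :=
  [set c | [/\ L1loc c,
    {ae @lebesgue_measure R, forall t : R, 0 <= t -> 0 <= c t} &
    exists2 k : R -> R, state_solution F k0 c k &
      forall t : R, 0 <= t -> 0 <= k t]].

(* The integrand is nonnegative almost everywhere for admissible [c], so that
   the integral is well defined in [0, +oo]. *)
Definition total_utility (R : realType) (rho : R) (u c : R -> R) : \bar R :=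
  (\int[@lebesgue_measure R]_(t in `[0%R, +oo[)
     (expR (- (rho * t)) * u (c t))%:E)%E.

Definition ext_value (R : realType) (rho : R) (F u : R -> R) (k0 : R) :
    \bar R :=
  ereal_sup [set total_utility rho u c | c in admissible F k0].

Definition value (R : realType) (rho : R) (F u : R -> R) (k0 : R) : R :=
  fine (ext_value rho F u k0).

(* Main.v *)
(* An absolutely continuous function whose derivative is almost everywhere
   nonpositive is nonincreasing; applied to exp(-g t) (k(t) + C/g), this turns
   an affine bound F(x) <= g x + C into the budget constraint
   int_0^oo exp(-g t) c(t) dt <= k0 + C/g for every admissible c.
   Concavity and u(0) = 0 give u(c) <= u(a) (1 + c/a) for every a > 0.  With
   a(t) = A exp(g t), g = L + eps0, the growth hypothesis on u yields
   exp(-rho t) u(a(t)) <= S exp(-e t) with e = eps0/2, hence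
   V(k) <= S/e + (S/A) (k + C/g).  Here S = o(A) as A -> +oo, and A = k gives
   (ii); S -> 0 as A -> 0, and bounding early consumption by means of
   F(x) <= M x instead gives (iii).  The constant control c = F(k) gives (i). *)
Require Import Defs.
From HB Require Import structures.
From mathcomp Require Import all_boot all_order all_algebra.
From mathcomp Require Import all_classical all_reals all_analysis.
From mathcomp Require Import measurable_realfun ring lra.

Set Implicit Arguments.
Unset Strict Implicit.
Unset Printing Implicit Defensive.

Import Order.TTheory GRing.Theory Num.Theory.
Import numFieldNormedType.Exports.
Import HBNNSimple.

Local Open Scope classical_set_scope.
Local Open Scope ring_scope.

(** * Derivatives almost everywhere and increments of absolutely continuous functions *)

(** Adds the difference quotient bounds on the two sides of [s], so that [p] and [q] can move
    independently, as the real induction below requires. *)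
Lemma is_derive_straddle_le (R : realType) (f : R -> R) (s d e : R) :
  is_derive s 1 f d -> d < e ->
  exists2 r, 0 < r & forall p q, s - r < p -> p <= s -> s <= q -> q < s + r ->
    f q - f p <= e * (q - p).
Proof.
move=> [df Df] de.
have : h^-1 *: (f (h *: 1 + s) - f s) @[h --> 0^'] --> d.
  by move: df; rewrite -Df /derive => /cvgP; exact.
move=> /cvgrPdist_lt /(_ (e - d)); rewrite subr_gt0 => /(_ de).
rewrite near_withinE => /nbhs_ballP[r /= r0 hr]; exists r => // p q sp ps sq qs.
have step h : `|h| < r -> h != 0 -> h^-1 * (f (h + s) - f s) < e.
  move=> hlt h0; have /= := hr h; rewrite /ball /= sub0r normrN => /(_ hlt h0).
  rewrite /GRing.scale /= mulr1 ltr_distlC => /andP[_].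
  by rewrite subrKC.
have fq : f q - f s <= e * (q - s).
  have [->|qs0] := eqVneq q s; first by rewrite !subrr mulr0.
  have h0 : 0 < q - s by rewrite subr_gt0 lt_neqAle eq_sym qs0.
  have := step (q - s); rewrite gtr0_norm// subrK lt0r_neq0// => /(_ _ isT).
  by rewrite mulrC ltr_pdivrMr// => H; apply/ltW/H; lra.
have fp : f s - f p <= e * (s - p).
  have [->|ps0] := eqVneq p s; first by rewrite !subrr mulr0.
  have h0 : p - s < 0 by rewrite subr_lt0 lt_neqAle ps0.
  have := step (p - s); rewrite ltr0_norm// subrK ltr0_neq0// => /(_ _ isT).
  rewrite mulrC ltr_ndivrMr// => H; have {}H := ltW (H _); lra.
lra.
Qed.

(** Turns the total length occurring in the definition of absolute continuity into the measure of a
    set. *)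
Lemma lebesgue_measure_disjoint_itvoo (R : realType) (n : nat) (x y : nat -> R) :
  (forall i, (i < n)%N -> x i <= y i) ->
  trivIset `I_n (fun i => `]x i, y i[%classic) ->
  lebesgue_measure (\big[setU/set0]_(i < n) `]x i, y i[%classic) =
  (\sum_(i < n) (y i - x i))%:E.
Proof.
move=> xy txy; rewrite -sumEFin measure_semi_additive_ord//=.
- apply: eq_bigr => i _; rewrite lebesgue_measure_itv/= lte_fin.
  case: ltP => [//|yx].
  have -> : x i = y i by apply/eqP; rewrite eq_le yx xy.
  by rewrite subrr.
- by move=> i j _ _ ij; apply/val_inj/txy => //=; exact: ltn_ord.
- exact: bigsetU_measurable.
Qed.

(* Real induction on [a, b]: the increments of [f] are controlled by the slope
   off an open set [U] of small measure containing the exceptional points, and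
   by the variation of [f] over finitely many disjoint intervals in [U]. *)
Lemma ac_nonincreasing (R : realType) (a b : R) (f : R -> R) :
  a <= b -> absolutely_continuous_on a b f ->
  {ae @lebesgue_measure R, forall t, a < t < b ->
     exists2 d, is_derive t 1 f d & d <= 0} ->
  f b <= f a.
Proof.
move=> ab acf [N [mN N0 badN]]; pose mu := @lebesgue_measure R.
apply/ler_addgt0Pr => e0 e00.
(* Splits the tolerance: [e * (b - a)] pays for the slope and one more [e] for the variation inside
   [U]. The [+ 1] covers the case [a = b]. *)
pose e := e0 / (b - a + 1).
have e_gt0 : 0 < e by rewrite divr_gt0// ltr_wpDl// subr_ge0.
have e0E : e0 = e * (b - a) + e.
  by rewrite -[in RHS](mulr1 e) -mulrA mul1r -mulrDr divfK// gt_eqF// ltr_wpDl// subr_ge0.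
have [dl dl0 hdl] := acf e e_gt0.
(* The endpoints join the exceptional set because the derivative is only controlled on the open
   interval. *)
pose N' := N `|` ([set a] `|` [set b]).
have mN' : measurable N' by do 2 apply: measurableU => //.
have N'0 : mu N' = 0.
  apply/eqP; rewrite eq_le measure_ge0 andbT.
  rewrite (le_trans (measureU2 _ _ _))//; first exact: measurableU.
  have m1 x : mu [set x] = 0%E by exact: lebesgue_measure_set1.
  rewrite [X in (X + _)%E](_ : _ = 0%E)// add0e.
  have m2 : (mu [set a] + mu [set b] <= 0)%E by rewrite !m1 adde0.
  by apply: le_trans m2; apply: measureU2.
have N'y : (mu N' < +oo)%E by rewrite N'0.
have [U [oU N'U UN']] := lebesgue_regularity_outer mN' N'y dl0.
have muU : (mu U < dl%:E)%E.
  have mU : measurable U by exact: open_measurable.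
  apply: le_lt_trans UN'.
  have : (mu ((U `\` N') `|` N') <= mu (U `\` N') + mu N')%E.
    by apply: measureU2 => //; exact: measurableD.
  by rewrite N'0 adde0 setUC setDUK.
pose inU (n : nat) (x y : nat -> R) t := forall i, (i < n)%N ->
  [/\ a <= x i, x i <= y i, y i <= t & `]x i, y i[ `<=` U].
pose good t := a <= t <= b /\ exists n (x y : nat -> R), [/\ inU n x y t,
  trivIset `I_n (fun i => `]x i, y i[%classic) &
  f t - f a <= e * (t - a) + \sum_(i < n) `|f (y i) - f (x i)|].
have good_a : good a.
  split; first by rewrite lexx.
  exists 0%N, (fun=> 0), (fun=> 0); split => //.
  by rewrite big_ord0 !subrr mulr0 addr0.
(* If []p, q[] lies in [U], it is appended to the list as entry [n], disjoint from the others since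
   they all end by [p]. Otherwise the slope term absorbs the increment. *)
have extend p q : good p -> p <= q -> q <= b ->
    `]p, q[ `<=` U \/ f q - f p <= e * (q - p) -> good q.
  move=> [/andP[ap pb] [n [x [y [xyU txy fp]]]]] pq qb [pqU|fpq].
    split; first by rewrite (le_trans ap).
    pose x' i := if (i < n)%N then x i else p.
    pose y' i := if (i < n)%N then y i else q.
    exists n.+1, x', y'; split.
    - move=> i; rewrite ltnS /x' /y'; case: ltnP => [ilt _|_ _]; last by split.
      by have [? ? ? ?] := xyU i ilt; split => //; apply: le_trans pq.
    - move=> i j /=; rewrite /x' /y' !ltnS => ilen jlen.
      case: (ltnP i n) => [ilt|ige]; case: (ltnP j n) => [jlt|jge].
      + exact: txy.
      + have [_ _ yip _] := xyU i ilt; move=> [z /= []]; rewrite !in_itv /=.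
        by move=> /andP[_ z1] /andP[z2 _]; move: (lt_le_trans z1 yip); rewrite ltNge (ltW z2).
      + have [_ _ yip _] := xyU j jlt; move=> [z /= []]; rewrite !in_itv /=.
        by move=> /andP[z2 _] /andP[_ z1]; move: (lt_le_trans z1 yip); rewrite ltNge (ltW z2).
      + by move=> _; apply/eqP; rewrite eqn_leq (leq_trans ilen)// (leq_trans jlen).
    - rewrite big_ord_recr/= /x' /y' ltnn.
      rewrite [X in _ <= _ + (X + _)](_ : _ = \sum_(i < n) `|f (y i) - f (x i)|); last first.
        by apply: eq_bigr => i _; rewrite ltn_ord.
      have := ler_norm (f q - f p).
      have : e * (p - a) <= e * (q - a) by rewrite ler_pM2l// lerB.
      lra.
  split; first by rewrite (le_trans ap).
  exists n, x, y; split => //.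
    by move=> i ilt; have [? ? ? ?] := xyU i ilt; split => //; apply: le_trans pq.
  move: fp fpq; rewrite -/e; lra.
(* An exceptional point is interior to [U]; at any other point the derivative is at most 0, hence
   less than [e]. *)
have local s : a <= s <= b -> exists2 r, 0 < r & forall p q, s - r < p -> p <= s ->
    s <= q -> q < s + r -> `]p, q[ `<=` U \/ f q - f p <= e * (q - p).
  move=> /andP[as_ sb].
  have [sN'|sN'] := pselect (N' s).
    have /nbhs_ballP[r /= r0 rU] : nbhs s U.
      by apply: open_nbhs_nbhs; split => //; apply: N'U.
    exists r => // p q sp ps sq qs; left => z /=; rewrite in_itv/= => /andP[pz zq].
    by apply: rU; rewrite /ball /= ltr_distlC; apply/andP; split; lra.
  have sab : a < s < b.
    rewrite !lt_neqAle as_ sb !andbT; apply/andP; split; apply/eqP => E; apply: sN'.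
      by right; left; rewrite E.
    by right; right; rewrite E.
  have [d Df d0] : exists2 d, is_derive s 1 f d & d <= 0.
    apply: contrapT => H; apply: sN'; left; apply: badN => /= H'.
    by apply: H; apply: H'.
  have [r r0 hr] := is_derive_straddle_le Df (le_lt_trans d0 e_gt0).
  by exists r => // p q sp ps sq qs; right; apply: hr.
have hsG : has_sup good.
  by split; [exists a|exists b => t [/andP[]]].
(* A good [p] close to the supremum [s] is extended across [s] to [q]. As [q] is then good, it is
   either [b] or a good point beyond the supremum, which is absurd. *)
have good_b : good b.
  set s := sup good.
  have as_ : a <= s by apply: ub_le_sup good_a; case: hsG.
  have sb : s <= b by apply: ge_sup; [exists a|move=> t [/andP[]]].
  have [|r r0 hr] := local s; first by rewrite as_.
  have [p gp sp] := sup_adherent r0 hsG.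
  have ps : p <= s by apply: ub_le_sup gp; case: hsG.
  pose q := Num.min b (s + r / 2).
  have sq : s <= q by rewrite le_min sb lerDl divr_ge0// ltW.
  have gq : good q.
    apply: (extend p) => //; first exact: le_trans sq.
      by rewrite ge_min lexx.
    apply: hr => //; rewrite gt_min; apply/orP; right; lra.
  have qs : q <= s by apply: ub_le_sup gq; case: hsG.
  move: gq qs; rewrite /q; case: (leP b (s + r / 2)) => // _ _ H.
  by exfalso; lra.
have [_ [n [x [y [xyU txy]]]]] := good_b.
rewrite e0E => fb.
(* The slope is paid for. The remaining sum runs over disjoint intervals inside [U], so their total
   length is below [dl]. *)
suff : \sum_(i < n) `|f (y i) - f (x i)| < e by lra.
apply: hdl => //; first by move=> i /xyU[].
rewrite -lte_fin; apply: le_lt_trans muU.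
have sub : \big[setU/set0]_(i < n) `]x i, y i[%classic `<=` U.
  rewrite -(bigcup_mkord n (fun i => `]x i, y i[%classic)) => z [i /= ilt].
  by have [_ _ _] := xyU i ilt; apply.
rewrite -lebesgue_measure_disjoint_itvoo//; last by move=> i /xyU[].
apply: le_measure; rewrite ?inE.
- exact: bigsetU_measurable.
- exact: open_measurable.
- exact: sub.
Qed.

Lemma absolutely_continuousB (R : realType) (a b : R) (f g : R -> R) :
  absolutely_continuous_on a b f -> absolutely_continuous_on a b g ->
  absolutely_continuous_on a b (f \- g).
Proof.
move=> acf acg e e0; have e2 : 0 < e / 2 by rewrite divr_gt0.
have [d1 d10 h1] := acf _ e2; have [d2 d20 h2] := acg _ e2.
exists (Num.min d1 d2); first by rewrite lt_min d10.
move=> n x y xy txy; rewrite lt_min => /andP[s1 s2].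
rewrite [ltRHS]splitr.
apply: le_lt_trans (ltrD (h1 n x y xy txy s1) (h2 n x y xy txy s2)).
rewrite -big_split/=; apply: ler_sum => i _.
rewrite [leLHS](_ : _ = `|(f (y i) - f (x i)) - (g (y i) - g (x i))|); last first.
  by congr (`| _ |); ring.
exact: ler_normB.
Qed.

(** The sum of the increments is at most the integral of [|phi|] over the union of the intervals,
    which is small as soon as that union has small measure. *)
Lemma absolutely_continuous_integral (R : realType) (a b : R) (phi : R -> R) :
  lebesgue_measure.-integrable setT (EFin \o phi) ->
  absolutely_continuous_on a b
    (fun x => \int[@lebesgue_measure R]_(t in `]-oo, x]) phi t).
Proof.
move=> iphi e e0; have [d [d0 hd]] := integral_normr_continuous iphi e0.
exists d => // n x y xy txy sd; pose mu := @lebesgue_measure R.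
have iS A : measurable A -> mu.-integrable A (EFin \o phi).
  by move=> mA; apply: integrableS iphi.
have inS A : measurable A -> mu.-integrable A (EFin \o (fun t => `|phi t|)).
  by move=> mA; apply: integrable_norm; exact: iS.
pose D := \big[setU/set0]_(i < n) `]x i, y i[%classic.
have mD : measurable (D : set (measurableTypeR R)) by exact: bigsetU_measurable.
apply: le_lt_trans (hd D mD _); last first.
  have muD : lebesgue_measure D = (\sum_(i < n) (y i - x i))%:E.
    by apply: lebesgue_measure_disjoint_itvoo => // i /xy[].
  by move: sd; rewrite -lte_fin -muD.
rewrite -lee_fin /Rintegral fineK; last first.
  by apply: integrable_fin_num => //; exact: inS.
rewrite ge0_integral_bigsetU//=.
- rewrite -sumEFin; apply: lee_sum => i _.
  have [_ xyi _] := xy i (ltn_ord i).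
  rewrite -(fineK (integrable_fin_num _ (inS `]x i, y i[%classic _)))//= lee_fin.
  rewrite Rintegral_itvB//; [|exact: iS].
  rewrite -Rintegral_itv_bndo_bndc; last exact: iS.
  by apply: le_normr_Rintegral => //; exact: iS.
- by rewrite /index_enum -enumT enum_uniq.
- by move=> i j _ _ ij; apply/val_inj/txy => //=; exact: ltn_ord.
- by apply/measurable_EFinP/measurableT_comp => //;
    apply/measurable_EFinP; exact: (measurable_int mu (iS _ mD)).
Qed.

(** Once [phi] is extended by zero, its primitive [G] has derivative [phi] almost everywhere on the
    interval, and [ac_nonincreasing] applies to [f - G]. *)
Lemma ac_increment_le_integral (R : realType) (a b : R) (f phi : R -> R) :
  a <= b -> absolutely_continuous_on a b f ->
  lebesgue_measure.-integrable `[a, b] (EFin \o phi) ->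
  {ae @lebesgue_measure R, forall t, a < t < b ->
     exists2 d, is_derive t 1 f d & d <= phi t} ->
  f b - f a <= \int[@lebesgue_measure R]_(t in `[a, b]) phi t.
Proof.
move=> ab acf iphi df; pose mu := @lebesgue_measure R.
pose psi := phi \_ `[a, b].
have ipsi : mu.-integrable setT (EFin \o psi).
  rewrite [EFin \o psi](_ : _ = (EFin \o phi) \_ `[a, b]); last by rewrite restrict_EFin.
  by rewrite -integrable_mkcond.
pose G x := \int[mu]_(t in `]-oo, x]) psi t.
have lpsi : locally_integrable setT psi.
  by apply: open_integrable_locally => //; exact: openT.
have dG : {ae mu, forall x, derivable G x 1 /\ derive1 G x = psi x}.
  by apply: FTC1Ny => // y; apply: integrableS ipsi.
have : f b - G b <= f a - G a.
  apply: (@ac_nonincreasing _ a b (f \- G)) => //.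
    by apply: absolutely_continuousB => //; exact: absolutely_continuous_integral.
  move: df dG; apply: filterS2; first exact: (ae_filter_ringOfSetsType mu).
  move=> t dft [Gt dGt] atb.
  have [d ftd dphi] := dft atb.
  have Gt' : is_derive t 1 G (psi t) by split => //; rewrite -dGt derive1E.
  exists (d - psi t); first exact: is_deriveB.
  rewrite /psi patchE mem_set ?subr_le0//=.
  by case/andP: atb => /ltW ? /ltW ?; rewrite in_itv/=; apply/andP.
suff : G b - G a <= \int[mu]_(t in `[a, b]) phi t by lra.
rewrite Rintegral_itvB//; last by apply: integrableS ipsi.
rewrite Rintegral_itv_obnd_cbnd; last by apply: integrableS ipsi.
by under eq_Rintegral => t tab do rewrite /psi patchE tab.
Qed.

(** At tolerance 1, [f] varies by at most 1 over any length below [d]; finitely many steps of length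
    [d / 2] then reach every point from [a]. *)
Lemma absolutely_continuous_bounded (R : realType) (a b : R) (f : R -> R) :
  absolutely_continuous_on a b f ->
  exists2 K, 0 <= K & forall x, a <= x <= b -> `|f x| <= K.
Proof.
move=> acf; have [d d0 hd] := acf 1 ltr01.
have near_le x y : a <= x -> x <= y -> y <= b -> y - x < d -> `|f y - f x| <= 1.
  move=> ax xy yb yxd.
  have := hd 1%N (fun=> x) (fun=> y); rewrite !big_ord1 => H.
  apply/ltW/H => // i j /=; rewrite !ltnS !leqn0 => /eqP -> /eqP -> //.
have step n x : a <= x <= b -> x - a <= n%:R * (d / 2) -> `|f x - f a| <= n%:R.
  elim: n x => [|n IH] x /andP[ax xb].
    by rewrite mul0r => xa; have -> : x = a by [lra]; rewrite subrr normr0.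
  rewrite -natr1 mulrDl mul1r => xn.
  pose x' := Num.max a (x - d / 2).
  have ax' : a <= x' by rewrite le_max lexx.
  have x'x : x' <= x by rewrite ge_max ax/=; lra.
  have x'd : x - x' < d.
    have : x - d / 2 <= x' by rewrite le_max lexx orbT.
    lra.
  have IHx' : `|f x' - f a| <= n%:R.
    apply: IH; first by rewrite ax'/= (le_trans x'x).
    rewrite lerBlDr ge_max; apply/andP; split; last by lra.
    by rewrite lerDr mulr_ge0// divr_ge0// ltW.
  rewrite -(subrK (f x') (f x)) -addrA (le_trans (ler_normD _ _))// [leRHS]addrC.
  by apply: lerD => //; exact: near_le.
pose n := (Num.truncn ((b - a) / (d / 2))).+1.
exists (`|f a| + n%:R) => [|x xab]; first by rewrite addr_ge0.
rewrite -(subrK (f a) (f x)) addrC (le_trans (ler_normD _ _))// lerD2l.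
apply: step => //; rewrite -ler_pdivrMr ?divr_gt0//.
have := truncnS_gt ((b - a) / (d / 2)).
rewrite -/n => /ltW; apply: le_trans; rewrite ler_pM2r ?invr_gt0 ?divr_gt0//.
by case/andP: xab => _ xb; rewrite lerB.
Qed.

(** On the half-line the exponential is bounded by 1 and [g]-Lipschitz, while [f] is bounded; the
    increment of the product splits accordingly. *)
Lemma absolutely_continuous_expRM (R : realType) (b g : R) (f : R -> R) :
  0 <= g -> absolutely_continuous_on 0 b f ->
  absolutely_continuous_on 0 b (fun t => expR (- (g * t)) * f t).
Proof.
move=> g0 acf e e0; have e2 : 0 < e / 2 by rewrite divr_gt0.
have [K K0 fK] := absolutely_continuous_bounded acf.
have [d1 d10 h1] := acf _ e2.
(* [K * g] bounds the coefficient of [Y - X]; the added 1 allows division by [M]. *)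
pose M := K * g + 1; have M0 : 0 < M by rewrite ltr_wpDl// mulr_ge0.
exists (Num.min d1 (e / 2 / M)); first by rewrite lt_min d10 divr_gt0.
move=> n x y xy txy; rewrite lt_min => /andP[s1].
rewrite ltr_pdivlMr// mulr_suml => s2.
rewrite [ltRHS]splitr; apply: le_lt_trans (ltrD (h1 n x y xy txy s1) s2).
rewrite -big_split/=; apply: ler_sum => i _.
have [xi0 xyi yib] := xy i (ltn_ord i).
set X := x i; set Y := y i.
have Ey : expR (- (g * Y)) <= 1 by rewrite expR_le1 oppr_le0 mulr_ge0// (le_trans xi0).
have Ex : expR (- (g * X)) <= 1 by rewrite expR_le1 oppr_le0 mulr_ge0.
have ExEy : `|expR (- (g * Y)) - expR (- (g * X))| <= g * (Y - X).
  rewrite distrC ger0_norm; last first.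
    by rewrite subr_ge0 ler_expR lerN2 ler_wpM2l.
  have -> : expR (- (g * Y)) = expR (- (g * X)) * expR (- (g * (Y - X))).
    by rewrite -expRD; congr expR; ring.
  rewrite -[X in X - _]mulr1 -mulrBr.
  have H : 1 - expR (- (g * (Y - X))) <= g * (Y - X).
    by have := expR_ge1Dx (- (g * (Y - X))); lra.
  have H0 : 0 <= g * (Y - X) by rewrite mulr_ge0// subr_ge0.
  by apply: le_trans (ler_wpM2l (expR_ge0 _) H) _; rewrite ler_piMl.
rewrite (_ : _ - _ = expR (- (g * Y)) * (f Y - f X) +
  f X * (expR (- (g * Y)) - expR (- (g * X)))); last by ring.
apply: (le_trans (ler_normD _ _)); rewrite !normrM; apply: lerD.
  by rewrite (ger0_norm (expR_ge0 _)) ler_piMl.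
rewrite [leRHS]mulrC /M mulrDl mul1r ler_wpDr ?subr_ge0// -mulrA.
by apply: ler_pM => //; apply: fK; rewrite xi0/= (le_trans xyi).
Qed.

(** * Discounted integrals and the budget constraint *)

Lemma measurable_expRNM (R : realType) (g : R) (D : set (measurableTypeR R)) :
  measurable_fun D (fun t : R => expR (- (g * t))).
Proof.
apply: measurable_funTS; apply: measurableT_comp => //.
by apply: measurableT_comp => //; apply: measurable_funM.
Qed.

Lemma integrable_discounted (R : realType) (g T : R) (c : R -> R) :
  0 <= g -> lebesgue_measure.-integrable `[0, T] (EFin \o c) ->
  lebesgue_measure.-integrable `[0, T]
    (EFin \o (fun t => expR (- (g * t)) * `|c t|)).
Proof.
move=> g0 ic.
pose h (t : R) := expR (- (g * t)); pose k t := `|c t|.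
rewrite -[EFin \o _]/((EFin \o h) \* (EFin \o k))%E.
apply: integrableMr => //; first exact: measurable_expRNM.
  exists 1; split => // M M1 t /=; rewrite in_itv/= => /andP[t0 _].
  rewrite (ger0_norm (expR_ge0 _)) (le_trans _ (ltW M1))//.
  by rewrite expR_le1 oppr_le0 mulr_ge0.
exact: integrable_norm.
Qed.

(** Monotone convergence along the intervals [[0, n + 1]]. *)
Lemma le_integral_itv0y (R : realType) (f : R -> R) (B : R) :
  (forall t, 0 <= t -> 0 <= f t) ->
  (forall T, 0 <= T -> lebesgue_measure.-integrable `[0, T] (EFin \o f)) ->
  (forall T, 0 <= T -> \int[@lebesgue_measure R]_(t in `[0, T]) f t <= B) ->
  (\int[@lebesgue_measure R]_(t in `[0%R, +oo[) (f t)%:E <= B%:E)%E.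
Proof.
move=> f0 if_ fB; rewrite itv0y_bigcup0S.
have cv : (\int[@lebesgue_measure R]_(t in `[0%R, n.+1%:R]) (f t)%:E)%E @[n --> \oo] -->
    (\int[@lebesgue_measure R]_(t in \bigcup_n `[0%R, n.+1%:R]%classic) (f t)%:E)%E.
  apply: ge0_nondecreasing_set_cvg_integral => //.
  - move=> n m nm; apply/subsetPset => t /=; rewrite !in_itv/= => /andP[-> /le_trans]; apply.
    by rewrite ler_nat ltnS.
  - by move=> n; apply: (measurable_int lebesgue_measure); exact: if_.
  - by move=> n t /=; rewrite in_itv/= => /andP[/f0]; rewrite lee_fin.
rewrite -(cvg_lim _ cv)//; apply: lime_le; first exact: cvgP cv.
apply: nearW => n.
rewrite -(fineK (integrable_fin_num _ (if_ n.+1%:R _)))//= lee_fin.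
exact: fB.
Qed.

(* With h(t) = exp(-g t) (k(t) + C/g), the bound on F gives
   h' <= - exp(-g t) c almost everywhere, and h >= 0. *)
Lemma discounted_consumption_le (R : realType) (F c : R -> R) (k0 g C : R) :
  0 < g -> 0 <= C -> (forall x, 0 <= x -> F x <= g * x + C) ->
  admissible F k0 c ->
  (\int[@lebesgue_measure R]_(t in `[0%R, +oo[)
     (expR (- (g * t)) * `|c t|)%:E <= (k0 + C / g)%:E)%E.
Proof.
move=> g0 C0 Fg [L1c c0 [k [k_0 ack dk] kge0]].
apply: le_integral_itv0y => [t _|T T0|T T0].
- by rewrite mulr_ge0// expR_ge0.
- by apply: integrable_discounted; [exact: ltW|exact: L1c].
pose phi t := - (expR (- (g * t)) * `|c t|).
pose h t := expR (- (g * t)) * (k t + C / g).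
have ih := integrable_discounted (ltW g0) (L1c T T0).
have : h T - h 0 <= \int[@lebesgue_measure R]_(t in `[0, T]) phi t.
  apply: ac_increment_le_integral => //.
  - apply: absolutely_continuous_expRM; first exact: ltW.
    move=> e e0; have [d d0 hd] := ack T T0 e e0; exists d => // n x y xy txy s.
    rewrite (eq_bigr (fun i : 'I_n => `|k (y i) - k (x i)|)); first exact: hd.
    by move=> i _; congr (`| _ |); ring.
  - exact: integrableN ih.
  - move: c0 dk; apply: filterS2; first exact: (ae_filter_ringOfSetsType lebesgue_measure).
    move=> t ct kt /andP[/ltW t0 tT].
    have {}kt := kt t0; have {}ct := ct t0.
    have dE : is_derive t 1 (fun t : R => expR (- (g * t))) (expR (- (g * t)) * (- g)).
      apply: (@is_derive1_comp _ expR (fun t => - (g * t))).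
      have := is_deriveZ (- g) (is_derive_id t (1 : R)).
      rewrite [_ *: _]mulr1 (_ : _ \*: _ = (fun t => - (g * t)))//.
      by apply/funext => z; rewrite /= [LHS]mulNr.
    exists (expR (- (g * t)) * (F (k t) - c t) + (k t + C / g) * (expR (- (g * t)) * (- g))).
      have dkC : is_derive t 1 (fun t => k t + C / g) (F (k t) - c t).
        by have := is_deriveD kt (is_derive_cst (C / g) t 1); rewrite addr0.
      exact: is_deriveM dE dkC.
    rewrite /phi (ger0_norm ct).
    have gC : g * (C / g) = C by rewrite mulrCA divff ?mulr1// gt_eqF.
    have := Fg _ (kge0 t t0).
    rewrite -(ler_pM2l (expR_gt0 (- (g * t)))).
    set E := expR _; move: gC; set D := C / g => <-; lra.
have -> : \int[@lebesgue_measure R]_(t in `[0, T]) phi t =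
  - \int[@lebesgue_measure R]_(t in `[0, T]) (expR (- (g * t)) * `|c t|).
  rewrite -[RHS]mulN1r -RintegralZl//; apply: eq_Rintegral => t _.
  by rewrite mulN1r.
(* The value of [h] at [T] is nonnegative and is dropped; its value at 0 is the budget. *)
rewrite /h mulr0 oppr0 expR0 mul1r k_0.
have : 0 <= expR (- (g * T)) * (k T + C / g).
  by rewrite mulr_ge0 ?expR_ge0// addr_ge0 ?kge0// divr_ge0// ltW.
lra.
Qed.

(* [f] need not be measurable: its integral is then bounded through the simple
   functions below its positive part. *)
Lemma integral_le_ae (R : realType) (D : set (measurableTypeR R)) (f g : R -> R) :
  measurable D -> (forall t, 0 <= g t) -> measurable_fun D g ->
  {ae @lebesgue_measure R, forall t, D t -> f t <= g t} ->
  (\int[@lebesgue_measure R]_(t in D) (f t)%:E <=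
   \int[@lebesgue_measure R]_(t in D) (g t)%:E)%E.
Proof.
move=> mD g0 mg fg; pose mu := @lebesgue_measure R.
rewrite [in leRHS]integral_mkcond.
rewrite [leLHS]integralE.
apply: (@le_trans _ _ (\int[mu]_(t in D) ((EFin \o f)^\+ t))%E).
  by apply: geeDl; rewrite oppe_le0; apply: integral_ge0.
rewrite [leLHS]integral_mkcond [leLHS]ge0_integralTE; last by move=> t; rewrite patchE; case: ifPn.
apply: ge_ereal_sup => _ [h /= hf <-].
rewrite -integralT_nnsfun.
apply: ae_ge0_le_integral => //.
- by move=> t _; rewrite lee_fin.
- exact/measurable_EFinP.
- by move=> t _; rewrite patchE; case: ifPn => _; rewrite ?lee_fin.
- apply/(measurable_restrictT _ _).1 => //; exact/measurable_EFinP.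
move: fg; apply: filterS.
move=> t ft _; apply: le_trans (hf t) _; rewrite !patchE.
case: ifPn => // /set_mem Dt; rewrite funeposE ge_max !lee_fin g0 andbT.
exact: ft.
Qed.

(** The exponential distribution of rate [e] has total mass 1; divide by [e]. *)
Lemma integral_expRNM (R : realType) (e : R) : 0 < e ->
  (\int[@lebesgue_measure R]_(t in `[0%R, +oo[) (expR (- (e * t)))%:E = (e^-1)%:E)%E.
Proof.
move=> e0; have := integral_exponential_pdf e0.
have -> : (\int[@lebesgue_measure R]_x (exponential_pdf e x)%:E =
    \int[@lebesgue_measure R]_(t in `[0%R, +oo[) (e%:E * (expR (- (e * t)))%:E))%E.
  rewrite [RHS]integral_mkcond; apply: eq_integral => t _.
  rewrite /exponential_pdf !patchE; case: ifP => // _.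
  by rewrite mulNr EFinM.
rewrite ge0_integralZl//=.
- move=> /(congr1 (fun x => (e^-1)%:E * x)%E); rewrite mule1 muleA -EFinM mulVf ?gt_eqF//.
  by rewrite mul1e.
- by apply/measurable_EFinP; exact: measurable_expRNM.
- by rewrite lee_fin ltW.
Qed.

Lemma L1loc_measurable (R : realType) (c : R -> R) :
  L1loc c -> measurable_fun (`[0, +oo[%classic : set (measurableTypeR R)) c.
Proof.
move=> L1c; rewrite itv0y_bigcup0S; apply/measurable_fun_bigcup => // n.
by apply/measurable_EFinP; apply: (measurable_int lebesgue_measure); exact: L1c.
Qed.

(** * Growth of the utility and production functions *)

Lemma util_le (R : realType) (u : R -> R) : utility_function u ->
  forall x y, 0 <= x -> x <= y -> u x <= u y.
Proof.
move=> hu x y x0; rewrite le_eqVlt => /predU1P[->//|xy].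
by apply/ltW/(util_increasing hu); rewrite ?in_itv/= ?andbT// (le_trans x0)// ltW.
Qed.

Lemma util_ge0 (R : realType) (u : R -> R) : utility_function u ->
  forall x, 0 <= x -> 0 <= u x.
Proof. by move=> hu x x0; rewrite -(util_0 hu); apply: util_le. Qed.

(** For [c <= a] monotonicity gives [u a]. For [c > a], concavity and [u 0 = 0] give
    [u a * (c / a)]. The sum of the two bounds covers both cases. *)
Lemma util_le_affine (R : realType) (u : R -> R) : utility_function u ->
  forall a c, 0 < a -> 0 <= c -> u c <= u a * (1 + c / a).
Proof.
move=> hu a c a0 c0; have ua := util_ge0 hu (ltW a0).
have [ca|ac] := leP c a.
  apply: (le_trans (util_le hu c0 ca)).
  by rewrite ler_peMr// lerDl divr_ge0// ltW.
have c_gt0 : 0 < c by apply: lt_trans ac.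
have H : a / c * u c < u a.
  have := @util_concave _ _ hu c 0 (a / c) _ _ (lt0r_neq0 c_gt0) _.
  rewrite (util_0 hu) !mulr0 !addr0 divfK ?gt_eqF//; apply.
  - by rewrite /= in_itv/= c0.
  - by rewrite /= in_itv/= lexx.
  - by rewrite divr_gt0//= ltr_pdivrMr// mul1r.
have : u c <= u a * (c / a).
  have -> : u c = (a / c * u c) * (c / a) by field; rewrite !gt_eqF.
  by rewrite ler_wpM2r ?(ltW H)// divr_ge0// ltW.
by move=> /le_trans; apply; rewrite ler_wpM2l// lerDr.
Qed.

Lemma derive1_le_increment (R : realType) (f : R -> R) (a b g : R) :
  a <= b -> (forall x, a <= x <= b -> derivable f x 1) ->
  (forall x, a <= x <= b -> derive1 f x <= g) -> f b <= f a + g * (b - a).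
Proof.
move=> ab df dfg.
have [x||x] := @MVT_segment R f (derive1 f) a b ab.
- rewrite in_itv/= => /andP[/ltW ax /ltW xb]; split; last by rewrite derive1E.
  by apply: df; rewrite ax.
- apply: derivable_within_continuous => x; rewrite in_itv/=; exact: df.
rewrite in_itv/= => xab fE; rewrite -lerBlDl fE ler_wpM2r ?subr_ge0//; exact: dfg.
Qed.

Lemma derive1_cvg_le_affine (R : realType) (f : R -> R) (l g : R) :
  (forall x, 0 < x -> derivable f x 1) ->
  derive1 f x @[x --> +oo] --> l -> l < g ->
  exists2 X, 0 < X & forall x, X <= x -> f x <= f X + g * (x - X).
Proof.
move=> df fl lg.
have [X0 [_ hX0]] : \forall x \near +oo, derive1 f x < g by exact: (cvgr_lt l).
exists (Num.max 1 (X0 + 1)); first by rewrite lt_max ltr01.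
move=> x Xx; apply: derive1_le_increment => // z /andP[Xz zx].
  by apply: df; apply: lt_le_trans Xz; rewrite lt_max ltr01.
by apply/ltW/hX0; apply: lt_le_trans Xz; rewrite lt_max ltrDl ltr01 orbT.
Qed.

(** Eventually the slope is at most [eta / 2]; the other half of [eta] absorbs the constant [u X]
    for large [x]. *)
Lemma util_sublinear (R : realType) (u : R -> R) (eta : R) : utility_function u ->
  0 < eta -> exists2 X, 0 < X & forall x, X <= x -> u x <= eta * x.
Proof.
move=> hu eta0; have e2 : 0 < eta / 2 by rewrite divr_gt0.
have [X X0 hX] := derive1_cvg_le_affine (util_derivable hu) (util_deriv_pinfty hu) e2.
exists (Num.max X (u X / (eta / 2))); first by rewrite lt_max X0.
move=> x; rewrite ge_max ler_pdivrMr// => /andP[/hX ux uXx].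
apply: (le_trans ux).
have : 0 <= eta / 2 * X by rewrite mulr_ge0// ltW.
lra.
Qed.

Lemma prod_le (R : realType) (F : R -> R) (L x y : R) :
  production_function L F -> x <= y -> F x <= F y.
Proof.
move=> hF xy; have := @derive1_le_increment R (fun z => - F z) x y 0 xy.
rewrite mul0r addr0 lerN2; apply => z _.
  by apply: derivableN; exact: @prod_derivable _ _ _ hF z.
rewrite derive1E deriveN; last exact: @prod_derivable _ _ _ hF z.
by rewrite oppr_le0 -derive1E; apply/ltW; exact: @prod_deriv_gt0 _ _ _ hF z.
Qed.

Lemma prod_ge0 (R : realType) (F : R -> R) (L x : R) :
  production_function L F -> 0 <= x -> 0 <= F x.
Proof. by move=> hF x0; rewrite -(prod_0 hF); exact: prod_le hF x0. Qed.

(** Past some [X] the slope of [F] is below [g]; before [X], monotonicity bounds [F] by the constant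
    [F X]. *)
Lemma prod_le_affine (R : realType) (F : R -> R) (L g : R) :
  production_function L F -> L < g ->
  exists2 C, 0 <= C & forall x, 0 <= x -> F x <= g * x + C.
Proof.
move=> hF Lg; have g0 : 0 < g by apply: lt_trans Lg; exact: prod_lim_gt0 hF.
have [X X0 hX] := derive1_cvg_le_affine (fun x _ => @prod_derivable _ _ _ hF x)
  (prod_deriv_lim hF) Lg.
exists (F X); first exact: prod_ge0 hF (ltW X0).
move=> x x0; have [xX|/ltW Xx] := leP x X.
  by apply: (le_trans (prod_le hF xX)); rewrite lerDr mulr_ge0// ltW.
apply: (le_trans (hX _ Xx)); have : 0 < g * X by rewrite mulr_gt0.
lra.
Qed.

(** Having no constant term, this bound yields a budget that vanishes with the initial capital, as
    (iii) needs. The slope is the maximum of [F'] on [[0, X]] plus the slope [L + 1] valid beyond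
    [X]. *)
Lemma prod_le_linear (R : realType) (F : R -> R) (L : R) :
  production_function L F ->
  exists2 M, 0 < M & forall x, 0 <= x -> F x <= M * x.
Proof.
move=> hF; have L1 : L < L + 1 by rewrite ltrDl.
have L0 := prod_lim_gt0 hF.
have [X X0 hX] := derive1_cvg_le_affine (fun x _ => @prod_derivable _ _ _ hF x)
  (prod_deriv_lim hF) L1.
have [|x0 _ hx0] := @EVT_max R (derive1 F) 0 X (ltW X0).
  by apply: continuous_subspaceT => z; exact: @prod_C1 _ _ _ hF z.
pose M := derive1 F x0.
have M0 : 0 < M := @prod_deriv_gt0 _ _ _ hF x0.
have FM x : 0 <= x -> x <= X -> F x <= M * x.
  move=> x_ge0 xX; have := @derive1_le_increment R F 0 x M x_ge0.
  rewrite (prod_0 hF) add0r subr0; apply => z /andP[z0 zx].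
    exact: @prod_derivable _ _ _ hF z.
  by apply: hx0; rewrite in_itv/= z0 (le_trans zx).
exists (M + (L + 1)) => [|x x_ge0]; first by rewrite !addr_gt0.
have [xX|/ltW Xx] := leP x X.
  by apply: (le_trans (FM _ x_ge0 xX)); rewrite ler_wpM2r//; lra.
apply: (le_trans (hX _ Xx)).
have := FM X (ltW X0) (lexx _).
have : M * X <= M * x by rewrite ler_pM2l.
have : 0 <= (L + 1) * X by rewrite mulr_ge0// ltW// addr_gt0.
lra.
Qed.

(** * Upper and lower bounds for the value function *)

(* Uses u(c) <= u(a) (1 + c / a) with the reference path a(t) = A exp(g t). *)
Lemma total_utility_le (R : realType) (F u c : R -> R) (rho k0 A S e g W : R) :
  utility_function u -> admissible F k0 c -> 0 < A -> 0 <= S -> 0 < e ->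
  (forall t, 0 <= t ->
     expR (- (rho * t)) * u (A * expR (g * t)) <= S * expR (- (e * t))) ->
  (\int[@lebesgue_measure R]_(t in `[0%R, +oo[)
     (expR (- ((g + e) * t)) * `|c t|)%:E <= W%:E)%E ->
  (total_utility rho u c <= (S / e + S / A * W)%:E)%E.
Proof.
move=> hu [L1c c0 _] A0 S0 e0 uS cW.
have SA0 : 0 <= S / A by rewrite divr_ge0// ltW.
have mc : measurable_fun (`[0, +oo[%classic : set (measurableTypeR R))
    (fun t => expR (- ((g + e) * t)) * `|c t|).
  apply: measurable_funM; first exact: measurable_expRNM.
  by apply: measurableT_comp => //; exact: L1loc_measurable.
have me := @measurable_expRNM R e `[0, +oo[%classic.
have E0 t : 0 <= expR (- (e * t)) by exact: expR_ge0.
have C0 t : 0 <= expR (- ((g + e) * t)) * `|c t| by rewrite mulr_ge0// expR_ge0.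
apply: (@le_trans _ _ (\int[@lebesgue_measure R]_(t in `[0%R, +oo[)
    (S * expR (- (e * t)) + S / A * (expR (- ((g + e) * t)) * `|c t|))%:E)%E).
  apply: integral_le_ae => //.
  - by move=> t; rewrite addr_ge0// mulr_ge0.
  - by apply: measurable_funD; apply: measurable_funM.
  move: c0; apply: filterS; first exact: (ae_filter_ringOfSetsType lebesgue_measure).
  move=> t ct /=; rewrite in_itv/= andbT => t0.
  have {}ct := ct t0; rewrite (ger0_norm ct).
  pose a := A * expR (g * t); have a0 : 0 < a by rewrite mulr_gt0// expR_gt0.
  apply: (le_trans (ler_wpM2l (expR_ge0 _) (util_le_affine hu a0 ct))).
  rewrite [leLHS]mulrA.
  have ca : 0 <= 1 + c t / a by rewrite addr_ge0// divr_ge0// ltW.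
  apply: (le_trans (ler_wpM2r ca (uS t t0))).
  rewrite mulrDr mulr1 lerD2l.
  (* Dividing by the reference path raises the decay rate from [e] to [g + e], the rate weighted by
     [W]. *)
  have -> : expR (- ((g + e) * t)) = expR (- (e * t)) / expR (g * t).
    by rewrite -expRN -expRD; congr expR; ring.
  rewrite /a le_eqVlt; apply/orP; left; apply/eqP; field.
  by rewrite !gt_eqF// expR_gt0.
have mSe : measurable_fun (`[0, +oo[%classic : set (measurableTypeR R))
    (fun t => S * expR (- (e * t))) by exact: measurable_funM.
have mSc : measurable_fun (`[0, +oo[%classic : set (measurableTypeR R))
    (fun t => S / A * (expR (- ((g + e) * t)) * `|c t|)) by exact: measurable_funM.
under eq_integral do rewrite EFinD.
rewrite ge0_integralD//=; last 4 first.
- by move=> t _; rewrite lee_fin mulr_ge0.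
- exact/measurable_EFinP.
- by move=> t _; rewrite lee_fin mulr_ge0.
- exact/measurable_EFinP.
rewrite EFinD; apply: leeD.
  under eq_integral do rewrite EFinM.
  rewrite ge0_integralZl//=; last exact/measurable_EFinP.
  by rewrite integral_expRNM// -EFinM.
under eq_integral do rewrite EFinM.
rewrite ge0_integralZl//=.
- rewrite [leRHS]EFinM; apply: lee_wpmul2l => //; rewrite lee_fin.
- exact/measurable_EFinP.
Qed.

(** Past [Y] the limit keeps the product below 1; on [[0, Y]] monotonicity bounds it by its value at
    [Y] without the factor in [rho]. [K] is the sum of the two bounds. *)
Lemma discounted_util_le (R : realType) (u : R -> R) (g rho e : R) :
  utility_function u -> 0 < g -> 0 < rho -> 0 < e ->
  expR (e * t) * expR (- (rho * t)) * u (expR (g * t)) @[t --> +oo] --> (0 : R) ->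
  exists2 K, 0 <= K & forall t, 0 <= t ->
    expR (- (rho * t)) * u (expR (g * t)) <= K * expR (- (e * t)).
Proof.
move=> hu g0 rho0 e0 hlim.
have [X [_ hX]] : \forall t \near +oo,
    expR (e * t) * expR (- (rho * t)) * u (expR (g * t)) < 1.
  exact: (cvgr_lt (0 : R)).
pose Y := Num.max X 0.
have uY : 0 <= u (expR (g * Y)) by apply: util_ge0 => //; exact: expR_ge0.
have EY : 0 <= expR (e * Y) * u (expR (g * Y)) by rewrite mulr_ge0// expR_ge0.
exists (1 + expR (e * Y) * u (expR (g * Y))); first by rewrite addr_ge0.
move=> t t0; rewrite [in leRHS]expRN ler_pdivlMr ?expR_gt0//.
rewrite mulrC mulrA.
have [tY|Yt] := leP t Y; last first.
  rewrite (le_trans (ltW (hX t _)))//; last by rewrite lerDl.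
  by apply: le_lt_trans Yt; rewrite le_max lexx.
apply: (@le_trans _ _ (expR (e * Y) * u (expR (g * Y)))); last by rewrite lerDr.
apply: ler_pM.
- by rewrite mulr_ge0// expR_ge0.
- by apply: util_ge0 => //; exact: expR_ge0.
- apply: (@le_trans _ _ (expR (e * t))).
    by rewrite ler_piMr ?expR_ge0// expR_le1 oppr_le0 mulr_ge0// ltW.
  by rewrite ler_expR ler_pM2l.
- by apply: util_le => //; rewrite ?expR_ge0// ler_expR ler_pM2l.
Qed.

(* Half of the decay rate [2 * e] absorbs the tail after time [T]. *)
Lemma discounted_util_scaled_le (R : realType) (u : R -> R) (g rho e K : R) :
  utility_function u -> 0 < g -> 0 < rho -> 0 < e -> 0 <= K ->
  (forall t, 0 <= t ->
    expR (- (rho * t)) * u (expR (g * t)) <= K * expR (- (2 * e * t))) ->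
  forall A T t, 0 < A -> 0 <= T -> 0 <= t ->
    expR (- (rho * t)) * u (A * expR (g * t)) <=
    (u (A * expR (g * T)) * expR (e * T) + (1 + A) * K * expR (- (e * T))) *
      expR (- (e * t)).
Proof.
move=> hu g0 rho0 e0 K0 uK A T t A0 T0 t0.
have AE z : 0 <= A * expR (g * z) by rewrite mulr_ge0 ?expR_ge0// ltW.
have uA z := util_ge0 hu (AE z).
rewrite mulrDl.
have p1 : 0 <= u (A * expR (g * T)) * expR (e * T) * expR (- (e * t)).
  by rewrite !mulr_ge0 ?expR_ge0.
have p2 : 0 <= (1 + A) * K * expR (- (e * T)) * expR (- (e * t)).
  by rewrite !mulr_ge0 ?expR_ge0// addr_ge0// ltW.
(* The first summand serves [t <= T], where [exp(e (T - t)) >= 1]; the second serves [T <= t]. *)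
have [tT|/ltW Tt] := leP t T.
  apply: ler_wpDr => //; rewrite -mulrA -expRD.
  apply: (@le_trans _ _ (u (A * expR (g * t)))).
    by rewrite ler_piMl// expR_le1 oppr_le0 mulr_ge0// ltW.
  apply: (@le_trans _ _ (u (A * expR (g * T)))).
    by apply: util_le => //; rewrite ler_pM2l// ler_expR ler_pM2l.
  rewrite ler_peMr// -expR0 ler_expR subr_ge0 ler_pM2l//.
apply: ler_wpDl => //.
(* By [util_le_affine] at the point [exp(g t)], scaling by [A] costs at most a factor [1 + A]. *)
have H : u (A * expR (g * t)) <= u (expR (g * t)) * (1 + A).
  have := util_le_affine hu (expR_gt0 (g * t)) (AE t).
  by rewrite mulfK// gt_eqF// expR_gt0.
apply: (le_trans (ler_wpM2l (expR_ge0 _) H)); rewrite mulrA.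
have A1 : 0 <= 1 + A by rewrite addr_ge0// ltW.
apply: (le_trans (ler_wpM2r A1 (uK t t0))).
have eTt : e * T <= e * t by rewrite ler_pM2l.
have EE : expR (- (2 * e * t)) <= expR (- (e * T)) * expR (- (e * t)).
  rewrite -expRD ler_expR; lra.
by rewrite mulrAC [K * _]mulrC -[leRHS]mulrA ler_wpM2l// mulr_ge0.
Qed.

(** The witness solves [a * e * t = b], so that [exp(x) >= 1 + x] suffices. *)
Lemma expRN_small (R : realType) (e a b : R) : 0 < e -> 0 < a -> 0 <= b ->
  exists2 t, 0 <= t & b * expR (- (e * t)) <= a.
Proof.
move=> e0 a0 b0; exists (b / (a * e)); first by rewrite divr_ge0// mulr_ge0// ltW.
rewrite expRN ler_pdivrMr ?expR_gt0//.
apply: (@le_trans _ _ (a * (1 + e * (b / (a * e))))).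
  rewrite mulrDr mulr1 [X in _ + X](_ : _ = b) ?lerDr ?ltW//.
  by field; rewrite !gt_eqF.
by rewrite ler_pM2l// expR_ge1Dx.
Qed.

Lemma util_small (R : realType) (u : R -> R) (a : R) : utility_function u ->
  0 < a -> exists2 x, 0 < x & u x <= a.
Proof.
move=> hu a0; have [_ u0] := (continuous_within_itvcyP _ _).1 (util_continuous hu).
have : \forall x \near (0 : R)^'+, 0 < x /\ u x < a.
  near=> x; split; first by near: x; exact: nbhs_right_gt.
  near: x; apply: (cvgr_lt (u 0)) => //; by rewrite (util_0 hu).
by move=> /filter_ex[x [x0 /ltW uxa]]; exists x.
Unshelve. all: by end_near. Qed.

(** Consuming the whole output keeps the capital constant. *)
Lemma constant_admissible (R : realType) (F : R -> R) (L k : R) :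
  production_function L F -> 0 <= k -> admissible F k (fun=> F k).
Proof.
move=> hF k0; split.
- move=> T T0; apply: measurable_bounded_integrable => //.
    by rewrite /= lebesgue_measure_itv/=; case: ifP => _; rewrite ?ltry// -EFinB ltry.
  by exists `|F k|; split => // M FM t _; exact: ltW.
- by apply: aeW => t _; exact: prod_ge0 hF k0.
exists (fun=> k) => //; split => //.
- move=> T T0 e e0; exists 1 => // n x y _ _ _.
  by rewrite big1// => i _; rewrite subrr normr0.
by apply: aeW => t _; rewrite subrr; exact: is_derive_cst.
Qed.

Lemma ext_value_ge (R : realType) (F u : R -> R) (L rho k : R) :
  production_function L F -> 0 < rho -> utility_function u -> 0 <= k ->
  ((u (F k) / rho)%:E <= ext_value rho F u k)%E.
Proof.
move=> hF hrho hu k0; apply: ereal_sup_ubound; exists (fun=> F k).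
  exact: constant_admissible hF k0.
rewrite /total_utility; under eq_integral do rewrite EFinM.
rewrite ge0_integralZr//=.
- by rewrite integral_expRNM// mulrC EFinM.
- by apply/measurable_EFinP; exact: measurable_expRNM.
- by rewrite lee_fin; apply: util_ge0 => //; exact: prod_ge0 hF k0.
Qed.

(* The bounds [F x <= M * x] and [F x <= g * x + C] control the consumption
   before and after time [tau] respectively. *)
Lemma ext_value_le (R : realType) (F u : R -> R) (rho k A S M C e g tau : R) :
  utility_function u ->
  0 <= k -> 0 < A -> 0 <= S -> 0 < M -> 0 <= C -> 0 < e -> 0 < g ->
  (forall x, 0 <= x -> F x <= M * x) -> (forall x, 0 <= x -> F x <= g * x + C) ->
  (forall t, 0 <= t ->
     expR (- (rho * t)) * u (A * expR (g * t)) <= S * expR (- (e * t))) ->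
  (ext_value rho F u k <= (S / e + S / A *
    (expR (M * tau) * k + expR (- (e * tau)) * (k + C / g)))%:E)%E.
Proof.
move=> hu k0 A0 S0 M0 C0 e0 g0 FM Fg uS; apply: ge_ereal_sup => _ [c adc <-].
apply: (total_utility_le hu adc A0 S0 e0 uS).
have FM0 x : 0 <= x -> F x <= M * x + 0 by rewrite addr0; exact: FM.
have cM := discounted_consumption_le M0 (lexx 0) FM0 adc.
have cg := discounted_consumption_le g0 C0 Fg adc.
rewrite mul0r addr0 in cM.
have [L1c _ _] := adc.
have mc a : measurable_fun (`[0, +oo[%classic : set (measurableTypeR R))
    (fun t => expR (- (a * t)) * `|c t|).
  apply: measurable_funM; first exact: measurable_expRNM.
  by apply: measurableT_comp => //; exact: L1loc_measurable.
have c0 a t : 0 <= expR (- (a * t)) * `|c t| by rewrite mulr_ge0// expR_ge0.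
pose EM := expR (M * tau); pose Eg := expR (- (e * tau)).
have M'0 : 0 <= EM := expR_ge0 _. have g'0 : 0 <= Eg := expR_ge0 _.
(* For [t <= tau] the factor [EM] compensates [exp(-M t)]; for [t >= tau], [exp(-e t)] is at most
   [Eg]. *)
apply: (@le_trans _ _ (\int[@lebesgue_measure R]_(t in `[0%R, +oo[)
    (EM * (expR (- (M * t)) * `|c t|) + Eg * (expR (- (g * t)) * `|c t|))%:E)%E).
  apply: ge0_le_integral => //=.
  - exact/measurable_EFinP.
  - by apply/measurable_EFinP; apply: measurable_funD; exact: measurable_funM.
  move=> t; rewrite in_itv/= andbT => t0; rewrite lee_fin !mulrA -mulrDl.
  apply: ler_wpM2r => //; rewrite -!expRD.
  have [tt|/ltW tt] := leP t tau.
    rewrite ler_wpDr ?expR_ge0// ler_expR.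
    have : M * t <= M * tau by rewrite ler_pM2l.
    have : 0 <= (g + e) * t by rewrite mulr_ge0// ltW// addr_gt0.
    lra.
  rewrite ler_wpDl ?expR_ge0// ler_expR.
  have : e * tau <= e * t by rewrite ler_pM2l.
  lra.
under eq_integral do rewrite EFinD.
rewrite ge0_integralD//=; last 4 first.
- by move=> t _; rewrite lee_fin mulr_ge0.
- by apply/measurable_EFinP; exact: measurable_funM.
- by move=> t _; rewrite lee_fin mulr_ge0.
- by apply/measurable_EFinP; exact: measurable_funM.
rewrite EFinD; apply: leeD.
  under eq_integral do rewrite EFinM.
  rewrite ge0_integralZl//=; last exact/measurable_EFinP.
    by rewrite [leRHS]EFinM; apply: lee_wpmul2l => //; rewrite lee_fin.
under eq_integral do rewrite EFinM.
rewrite ge0_integralZl//=; last exact/measurable_EFinP.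
  by rewrite [leRHS]EFinM; apply: lee_wpmul2l => //; rewrite lee_fin.
Qed.

(** * Finiteness and limits of the value function *)

Theorem theorem18 (R : realType) (F u : R -> R) (L rho eps0 : R)
    (hF : production_function L F)
    (hrho : 0 < rho)
    (hu : utility_function u)
    (heps0 : 0 < eps0)
    (hlim : expR (eps0 * t) * expR (- (rho * t)) * u (expR ((L + eps0) * t))
              @[t --> +oo] --> (0 : R)) :
  (* V is real-valued on [0, +oo[ *)
  (forall k : R, 0 <= k -> ext_value rho F u k \is a fin_num) /\
  [/\ value rho F u k @[k --> +oo] --> +oo,
      value rho F u k / k @[k --> +oo] --> (0 : R) &
      value rho F u k @[k --> 0^'+] --> value rho F u 0 /\
      value rho F u 0 = 0].
Proof.
have L0 := prod_lim_gt0 hF.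
pose g := L + eps0; have g0 : 0 < g by rewrite addr_gt0.
(* [discounted_util_scaled_le] consumes the decay rate [2 * e = eps0] and returns the rate [e]. *)
pose e := eps0 / 2; have e0 : 0 < e by rewrite divr_gt0.
have [M M0 FM] := prod_le_linear hF.
have [C C0 Fg] : exists2 C, 0 <= C & forall x, 0 <= x -> F x <= g * x + C.
  by apply: prod_le_affine hF _; rewrite ltrDl.
have [K K0 uK] := discounted_util_le hu g0 hrho heps0 hlim.
pose S A T := u (A * expR (g * T)) * expR (e * T) + (1 + A) * K * expR (- (e * T)).
have S0 A T : 0 < A -> 0 <= S A T.
  move=> A0; have uA : 0 <= u (A * expR (g * T)).
    by apply: util_ge0 => //; rewrite mulr_ge0 ?expR_ge0// ltW.
  by rewrite addr_ge0// !mulr_ge0 ?expR_ge0// addr_ge0// ltW.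
have uS A T t : 0 < A -> 0 <= T -> 0 <= t ->
    expR (- (rho * t)) * u (A * expR (g * t)) <= S A T * expR (- (e * t)).
  apply: discounted_util_scaled_le => // {}t t0.
  by rewrite /e mulrCA divff ?mulr1//; exact: uK.
(* The parameters stay free: [A = 1], [T = tau = 0] for finiteness, [A = k] and [tau = 0] for (ii),
   a small [A] and a suitable [tau] for (iii). *)
pose B A T tau k := S A T / e + S A T / A *
    (expR (M * tau) * k + expR (- (e * tau)) * (k + C / g)).
have VB A T tau k : 0 < A -> 0 <= T -> 0 <= k ->
    (ext_value rho F u k <= (B A T tau k)%:E)%E.
  move=> A0 T0 k0; apply: (ext_value_le tau hu k0 A0 (S0 _ T A0) M0 C0 e0 g0 FM Fg).
  by move=> t t0; exact: uS.
have uF0 k : 0 <= k -> 0 <= u (F k) / rho.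
  by move=> k0; rewrite divr_ge0 ?(ltW hrho)//; apply: util_ge0 => //; exact: prod_ge0 hF k0.
have Vge k : 0 <= k -> ((u (F k) / rho)%:E <= ext_value rho F u k)%E.
  exact: ext_value_ge hF hrho hu.
have Vfin k : 0 <= k -> ext_value rho F u k \is a fin_num.
  move=> k0; rewrite ge0_fin_numE; last by apply: le_trans (Vge k k0); rewrite lee_fin uF0.
  exact: le_lt_trans (VB 1 0 0 k ltr01 (lexx _) k0) (ltry _).
have vge k : 0 <= k -> u (F k) / rho <= value rho F u k.
  by move=> k0; rewrite -lee_fin /value fineK ?Vfin// Vge.
have v0 k : 0 <= k -> 0 <= value rho F u k.
  by move=> k0; exact: le_trans (uF0 k k0) (vge k k0).
have vB A T tau k : 0 < A -> 0 <= T -> 0 <= k -> value rho F u k <= B A T tau k.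
  by move=> A0 T0 k0; rewrite -lee_fin /value fineK ?Vfin// VB.
(* Order of choices: [T] makes the summand of [S] containing [K] small, then [A] the other one, so
   that [S / e <= eta / 2]. With [S / A] now fixed, [tau] limits late consumption and finally [d]
   limits early consumption, to [eta / 4] each. *)
have v_near0 eta : 0 < eta ->
    exists2 d, 0 < d & forall k, 0 <= k -> k <= d -> value rho F u k <= eta.
  move=> eta0; pose a := eta * e / 4.
  have a0 : 0 < a by rewrite divr_gt0// mulr_gt0.
  have [T T0 hT] := expRN_small e0 a0 (mulr_ge0 (ler0n R 2) K0).
  have [x x0 ux] := util_small hu (divr_gt0 a0 (expR_gt0 (e * T))).
  (* The cap 1 gives [1 + A <= 2]; the other bound gives [A * exp(g T) <= x]. *)
  pose A := Num.min 1 (x / expR (g * T)).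
  have A0 : 0 < A by rewrite lt_min ltr01 divr_gt0// expR_gt0.
  have SA : S A T / e <= eta / 2.
    rewrite ler_pdivrMr//.
    have : u (A * expR (g * T)) * expR (e * T) <= a.
      rewrite -ler_pdivlMr ?expR_gt0//; apply: le_trans ux.
      apply: util_le => //; first by rewrite mulr_ge0 ?expR_ge0// ltW.
      by rewrite -ler_pdivlMr ?expR_gt0// ge_min lexx orbT.
    have : (1 + A) * K * expR (- (e * T)) <= a.
      apply: le_trans hT; rewrite ler_wpM2r ?expR_ge0// ler_wpM2r//.
      by rewrite -[leRHS]/(1 + 1 : R) lerD2l ge_min lexx.
    rewrite /S /a; lra.
  pose b := S A T / A; have b0 : 0 <= b by rewrite divr_ge0 ?S0// ltW.
  have eta4 : 0 < eta / 4 by rewrite divr_gt0.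
  have Cg : 0 <= 1 + C / g by rewrite addr_ge0// divr_ge0// ltW.
  have [tau _ htau] := expRN_small e0 eta4 (mulr_ge0 b0 Cg).
  have [d d0 hd] : exists2 d, 0 < d & b * expR (M * tau) * d <= eta / 4.
    have bM : 0 <= b * expR (M * tau) by rewrite mulr_ge0 ?expR_ge0.
    have bM1 : 0 < b * expR (M * tau) + 1 by rewrite ltr_wpDl.
    exists (eta / 4 / (b * expR (M * tau) + 1)); first by rewrite divr_gt0.
    by rewrite mulrA ler_pdivrMr// [leRHS]mulrC ler_wpM2r ?lerDl ?(ltW eta4).
  exists (Num.min 1 d); first by rewrite lt_min ltr01.
  move=> k k0; rewrite le_min => /andP[k1 kd].
  apply: (le_trans (vB A T tau k A0 T0 k0)); rewrite /B -/b.
  have : b * expR (M * tau) * k <= eta / 4.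
    by apply: le_trans hd; rewrite ler_wpM2l// mulr_ge0 ?expR_ge0.
  have : b * (1 + C / g) * expR (- (e * tau)) >= b * (k + C / g) * expR (- (e * tau)).
    by rewrite ler_wpM2r ?expR_ge0// ler_wpM2l// lerD2r.
  lra.
have v_0 : value rho F u 0 = 0.
  apply/eqP; rewrite eq_le v0 ?lexx// andbT; apply/ler_addgt0Pr => eta eta0.
  have [d d0 hd] := v_near0 eta eta0; rewrite add0r.
  by apply: hd => //; exact: ltW.
split=> //; split.
(* (i): the lower bound [u (F k) / rho] diverges with [F] and [u]. *)
- apply/cvgryPge => a.
  have uy : \forall y \near +oo, rho * a <= u y.
    by have /cvgryPge := util_pinfty hu; exact.
  have FU : \forall k \near +oo, rho * a <= u (F k) by exact: (prod_pinfty hF uy).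
  near=> k; have k0 : 0 <= k by near: k; exact: nbhs_pinfty_ge.
  apply: le_trans (vge k k0); rewrite ler_pdivlMr// mulrC.
  by near: k.
- apply/cvgrPdist_le => eta eta0.
  (* If [S k T <= a * k], then [B] at [A = k], [tau = 0] is at most [a * (k / e + 2 * k + C / g)],
     hence at most [a * D * k] when [k >= 1]. *)
  pose D := e^-1 + 2 + C / g.
  have D0 : 0 < D by rewrite ltr_wpDr ?divr_ge0 ?(ltW g0)// addr_gt0 ?invr_gt0.
  pose a := eta / D; have a0 : 0 < a by rewrite divr_gt0.
  have a4 : 0 < a / 2 by rewrite divr_gt0.
  have [T T0 hT] := expRN_small e0 a4 (mulr_ge0 (ler0n R 2) K0).
  (* [T] is fixed before [k], so sublinearity of [u] can be invoked with a slope that cancels both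
     exponentials. *)
  pose Eg := expR (g * T) * expR (e * T).
  have Eg0 : 0 < Eg by rewrite mulr_gt0 ?expR_gt0.
  have [X X0 hX] := util_sublinear hu (divr_gt0 a4 Eg0).
  near=> k.
  have k1 : 1 <= k by near: k; exact: nbhs_pinfty_ge.
  have k0 : 0 < k by apply: lt_le_trans k1.
  have Xk : X / expR (g * T) <= k by near: k; apply: nbhs_pinfty_ge; exact: num_real.
  rewrite sub0r normrN ger0_norm; last by rewrite divr_ge0 ?v0// ltW.
  rewrite ler_pdivrMr//.
  have Sk : S k T <= a * k.
    have : u (k * expR (g * T)) * expR (e * T) <= a / 2 * k.
      have /hX : X <= k * expR (g * T) by rewrite -ler_pdivrMr ?expR_gt0.
      move=> /(ler_wpM2r (expR_ge0 (e * T))) /le_trans; apply.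
      rewrite le_eqVlt; apply/orP; left; apply/eqP; rewrite /Eg; field.
      by rewrite !gt_eqF ?expR_gt0.
    have : (1 + k) * K * expR (- (e * T)) <= a / 2 * k.
      apply: (@le_trans _ _ (2 * K * expR (- (e * T)) * k)); last first.
        by rewrite ler_wpM2r// ltW.
      have : 0 <= K * expR (- (e * T)) * (k - 1).
        by rewrite !mulr_ge0 ?expR_ge0// subr_ge0.
      lra.
    rewrite /S; lra.
  apply: (le_trans (vB k T 0 k k0 T0 (ltW k0))); rewrite /B !mulr0 oppr0 expR0 !mul1r.
  have Ska : S k T / k <= a by rewrite ler_pdivrMr.
  have H1 : S k T / e <= a * k / e by rewrite ler_pM2r// invr_gt0.
  have Cg : 0 <= C / g by rewrite divr_ge0// ltW.
  have H2 : S k T / k * (k + (k + C / g)) <= a * (k + (k + C / g)).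
    by rewrite ler_wpM2r// !addr_ge0// ltW.
  have H3 : a * (C / g) <= a * (C / g) * k by rewrite ler_peMr// mulr_ge0// ltW.
  have -> : eta * k = a * k / e + a * (2 * k) + a * (C / g) * k.
    by rewrite -[eta](divfK (lt0r_neq0 D0)) -/a /D; ring.
  lra.
split; last exact: v_0.
rewrite v_0; apply/cvgrPdist_le => eta eta0.
have [d d0 hd] := v_near0 eta eta0.
near=> k; have k0 : 0 < k by near: k; exact: nbhs_right_gt.
rewrite sub0r normrN ger0_norm ?(v0 _ (ltW k0))//.
apply: hd; first exact: ltW.
by near: k; exact: nbhs_right_le.
Unshelve. all: by end_near. Qed.
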